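(* Let $F:\mathbb{R}^n\to\mathbb{R}^n$ be a polynomial map and let $$K=\{x\in\mathbb{R}^n: g_i(x)\le 0,\ i\in[m],\ h_j(x)=0,\ j\in[\ell]\}$$ be nonempty, where $g_1,\dots,g_m$ are convex polynomial functions and $h_1,\dots,h_\ell$ are affine functions on $\mathbb{R}^n$. Assume that the Abadie constraint qualification holds at every point of $K$. If for every $\alpha\subset[m]$ the rank of the matrix $D\Phi_\alpha(x,\lambda_\alpha)$ is constant for $(x,\lambda_\alpha)\in\mathbb{R}^n\times\mathbb{R}^{|\alpha|}$, with constant value denoted $\operatorname{rank}(D\Phi_\alpha)$, then $$\dim(\operatorname{Sol}(K,F))\le\max_{\alpha\subset[m]}\Big\{\min\{\dim(K_\alpha),\ n+|\alpha|+\ell-\operatorname{rank}(D\Phi_\alpha)\}\Big\}.$$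
   Context: Notation: $[m]=\{1,\dots,m\}$; subsets $\alpha\subset[m]$ may be empty or all of $[m]$. The solution set of the polynomial variational inequality is $\operatorname{Sol}(K,F)=\{x\in K:\langle F(x),y-x\rangle\ge 0\ \text{for all } y\in K\}$; it is a semialgebraic set. Pseudo-faces: for $\alpha\subset[m]$, $K_\alpha=\{x\in\mathbb{R}^n: g_i(x)=0\ \forall i\in\alpha,\ g_i(x)<0\ \forall i\in[m]\setminus\alpha,\ h_j(x)=0\ \forall j\in[\ell]\}$. For $\alpha\subset[m]$, write $g_\alpha=(g_i)_{i\in\alpha}$, $\lambda_\alpha=(\lambda_i)_{i\in\alpha}$, $h=(h_1,\dots,h_\ell)$, and define $\Phi_\alpha:\mathbb{R}^n\times\mathbb{R}^{|\alpha|}\times\mathbb{R}^\ell\to\mathbb{R}^{n+|\alpha|+\ell}$ by $$\Phi_\alpha(x,\lambda_\alpha,\mu)=\Big(F(x)+\sum_{i\in\alpha}\lambda_i\nabla g_i(x)+\sum_{j\in[\ell]}\mu_j\nabla h_j(x),\ g_\alpha(x),\ h(x)\Big)^T.$$ Its Jacobian does not depend on $\mu$ (since $h$ is affine) and is $$D\Phi_\alpha(x,\lambda_\alpha)=\begin{bmatrix} DF(x)+\sum_{i\in\alpha}\lambda_i\nabla^2 g_i(x) & \nabla g_\alpha(x) & \nabla h(x)\\ \nabla g_\alpha(x)^T&0&0\\ \nabla h(x)^T&0&0\end{bmatrix},$$ where $DF$ is the Jacobian of $F$, $\nabla^2 g_i$ is the Hessian of $g_i$, and $\nabla g_\alpha(x)$,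 $\nabla h(x)$ are the matrices whose columns are the gradients $\nabla g_i(x)$ ($i\in\alpha$) and $\nabla h_j(x)$ ($j\in[\ell]$). Abadie constraint qualification (ACQ) at $x\in K$: $L_K(x)=T_K(x)$, where $T_K(x)$ is the set of $v\in\mathbb{R}^n$ for which there are $y^k\in K$ and $t^k>0$ with $y^k\to x$, $t^k\to 0$, $(y^k-x)/t^k\to v$; and $L_K(x)=\{v:\langle\nabla g_i(x),v\rangle\le 0\ \forall i\in I(x),\ \langle\nabla h_j(x),v\rangle=0\ \forall j\in[\ell]\}$ with $I(x)=\{i\in[m]:g_i(x)=0\}$. Dimension: every semialgebraic set $S$ is a finite disjoint union of semialgebraic subsets $S_i$ semialgebraically diffeomorphic to $(0,1)^{d_i}$ (with $(0,1)^0$ a point), and $\dim S=\max_i d_i$; convention $\dim(\emptyset)=-\infty$. *)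

(* Defs.v *)
From HB Require Import structures.
From mathcomp Require Import all_boot all_order all_algebra.
From mathcomp Require Import all_classical all_reals all_analysis.
(* Not imported: its notations clash with those of mathcomp-analysis. *)
From mathcomp Require mpoly.

Set Implicit Arguments.
Unset Strict Implicit.
Unset Printing Implicit Defensive.

Import Order.TTheory GRing.Theory Num.Theory numFieldNormedType.Exports.
Local Open Scope classical_set_scope.
Local Open Scope ring_scope.

Notation mpolynomial R n := (mpoly.mpoly n R).

Section Polynomials.
Context {R : realType} {n : nat}.
Implicit Types (p : mpolynomial R n) (x : 'rV[R]_n).

Definition peval p x : R := mpoly.meval (x 0) p.

(* Gradients are columns although points are rows, so that the matrix of the
   KKT system below is written as usual. *)
Definition grad p x : 'cV[R]_n := \col_i peval (mpoly.mderiv i p) x.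

Definition hess p x : 'M[R]_n :=
  \matrix_(i, j) peval (mpoly.mderiv j (mpoly.mderiv i p)) x.

Definition convex_poly p :=
  convex_function (E := 'rV[R]_n) setT (fun x => peval p x).

Definition affine_poly p :=
  exists (a : 'cV[R]_n) (b : R), forall x, peval p x = (x *m a) 0 0 + b.

End Polynomials.

Section Semialgebraic.
Context {R : realType}.

(* Each pair (ps, qs) of the list [D] encodes the set of the points where all
   the polynomials in ps vanish and all the polynomials in qs are positive. *)
Definition semialgebraic n (S : set 'rV[R]_n) :=
  exists D : seq (seq (mpolynomial R n) * seq (mpolynomial R n)),
    S = [set x | has (fun b => all (fun p => peval p x == 0) b.1 &&
                               all (fun q => 0 < peval q x) b.2) D].

Definition semialgebraic_fun p q (A : set 'rV[R]_p) (f : 'rV[R]_p -> 'rV[R]_q) :=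
  semialgebraic [set row_mx x (f x) | x in A].

(* f is of class C^k on U, for U open: the iterated partial derivatives up to
   order k exist and are continuous on U. *)
Fixpoint class_C p q (k : nat) (U : set 'rV[R]_p) (f : 'rV[R]_p -> 'rV[R]_q)
    : Prop :=
  (forall x, U x -> {for x, continuous f}) /\
  if k is k'.+1 then
    forall i : 'I_p, (forall x, U x -> derivable f x (delta_mx 0 i)) /\
                     class_C k' U (fun x => 'D_(delta_mx 0 i) f x)
  else True.

(* On a set that need not be open, f is smooth when it locally extends to
   C^infty maps defined on open sets. *)
Definition smooth_on p q (A : set 'rV[R]_p) (f : 'rV[R]_p -> 'rV[R]_q) :=
  forall x, A x -> exists (U : set 'rV[R]_p) (f' : 'rV[R]_p -> 'rV[R]_q),
    [/\ open U, U x, forall k, class_C k U f' &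
        forall y, A y -> U y -> f' y = f y].

Definition semialgebraic_diffeo p q (A : set 'rV[R]_p) (B : set 'rV[R]_q)
    (f : 'rV[R]_p -> 'rV[R]_q) :=
  [/\ set_bij A B f, semialgebraic_fun A f, smooth_on A f &
      exists2 f' : 'rV[R]_q -> 'rV[R]_p,
        (forall x, A x -> f' (f x) = x) & smooth_on B f'].

Definition open_cube d : set 'rV[R]_d := [set t | forall i, 0 < t 0 i < 1].

Definition cell_decomposition n (S : set 'rV[R]_n) N
    (C : 'I_N -> set 'rV[R]_n) (e : 'I_N -> nat) :=
  [/\ S = \bigcup_i C i, trivIset setT C, forall i, semialgebraic (C i) &
      forall i, exists f, semialgebraic_diffeo (@open_cube (e i)) (C i) f].

(* [has_dim S d] reads dim S = d. That such a d exists, for S semialgebraic,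
   and is unique, are theorems; hence the relation rather than a function. The
   empty decomposition gives dimension -oo to the empty set, and only to it. *)
Definition has_dim n (S : set 'rV[R]_n) (d : \bar int) :=
  exists N (C : 'I_N -> set 'rV[R]_n) (e : 'I_N -> nat),
    cell_decomposition S C e /\
    d = \big[Order.max/-oo%E]_(i < N) (e i)%:Z%:E.

End Semialgebraic.

Section VariationalInequality.
Context {R : realType} {n m l : nat}.
Variables (F : 'I_n -> mpolynomial R n).
Variables (g : 'I_m -> mpolynomial R n) (h : 'I_l -> mpolynomial R n).
Implicit Types (x v : 'rV[R]_n) (alpha : {set 'I_m}).

Definition poly_map x : 'rV[R]_n := \row_i peval (F i) x.

Definition Sol (K : set 'rV[R]_n) : set 'rV[R]_n :=
  [set x | K x /\ forall y, K y -> 0 <= (poly_map x *m (y - x)^T) 0 0].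

Definition feasible_set : set 'rV[R]_n :=
  [set x | (forall i, peval (g i) x <= 0) /\ (forall j, peval (h j) x = 0)].

Definition pseudo_face alpha : set 'rV[R]_n :=
  [set x | [/\ forall i, i \in alpha -> peval (g i) x = 0,
               forall i, i \notin alpha -> peval (g i) x < 0 &
               forall j, peval (h j) x = 0]].

Definition tangent_cone (K : set 'rV[R]_n) x : set 'rV[R]_n :=
  [set v | exists (y : nat -> 'rV[R]_n) (t : nat -> R),
     [/\ forall k, K (y k), forall k, 0 < t k, y @ \oo --> x, t @ \oo --> 0 &
         (fun k => (t k)^-1 *: (y k - x)) @ \oo --> v]].

Definition linearized_cone x : set 'rV[R]_n :=
  [set v | (forall i, peval (g i) x = 0 -> (v *m grad (g i) x) 0 0 <= 0) /\
           (forall j, (v *m grad (h j) x) 0 0 = 0)].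

Definition ACQ x := linearized_cone x = tangent_cone feasible_set x.

Definition jacF x : 'M[R]_n :=
  \matrix_(i, j) peval (mpoly.mderiv j (F i)) x.

Definition grad_g alpha x : 'M[R]_(n, #|alpha|) :=
  \matrix_(i, k) grad (g (enum_val k)) x i 0.

Definition grad_h x : 'M[R]_(n, l) := \matrix_(i, j) grad (h j) x i 0.

(* The Jacobian of (x, lambda, mu) |->
     (F x + \sum_(i in alpha) lambda_i grad g_i x + \sum_j mu_j grad h_j x,
      g_alpha x, h x);
   the Hessians of the h j vanish, the h j being affine. *)
Definition DPhi alpha x (lambda : 'rV[R]_#|alpha|)
    : 'M[R]_(n + (#|alpha| + l)) :=
  block_mx (jacF x + \sum_k lambda 0 k *: hess (g (enum_val k)) x)
           (row_mx (grad_g alpha x) (grad_h x))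
           (col_mx (grad_g alpha x)^T (grad_h x)^T)
           0.

End VariationalInequality.

(* Main.v *)
From HB Require Import structures.
Require Import Defs.
From mathcomp Require Import all_boot all_order all_algebra.
From mathcomp Require Import all_classical all_reals all_analysis.
From mathcomp Require Import ring.
From mathcomp Require Import (canonicals, coercions) mpoly.
Import Order.TTheory GRing.Theory Num.Theory numFieldNormedType.Exports.
Local Open Scope classical_set_scope.
Local Open Scope ring_scope.

(** Everything is local and happens on one cell of the solution set, seen
    through its smooth chart f : (0,1)^e -> Sol(K, F). It is enough to find,
    for each such chart, a subset alpha with e <= dim K_alpha and
    e + rank(DPhi_alpha) <= n + |alpha| + l.

    The choice of alpha. The set of the constraints that are inactive at f t
    can only grow when t moves a little, so its cardinal is lower
    semicontinuous, and a lower semicontinuous function with finitely many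
    values is constant near a point where it is maximal. Hence f maps some
    nonempty open V into a single pseudo-face K_alpha
    ([locally_in_pseudo_face]).

    First bound. The cells D_j of K_alpha are finitely many, so one of the
    preimages of the D_j under f is dense in a nonempty open subset of V
    ([finite_cover_somewhere_dense]). If psi is the chart of this D_j, then
    f = psi o phi holds on the dense set for a smooth phi defined near one of
    its points, hence near this point by continuity; as f locally has a smooth
    left inverse, the identity of R^e factors through R^d with d = dim D_j, and
    e <= d ([chart_dim_le_dense]).

    Second bound. At a solution x in K_alpha, the qualification condition
    turns the variational inequality into F x in the span of the gradients of
    the active constraints ([KKT_span]). This is a linear system
    A(x) nu = - F(x) in the multipliers nu. By semicontinuity again, the rank
    of A (f t) is constant near some t in V, and there Cramer's rule provides
    multipliers nu t that are differentiable ([differentiable_solution]). Thus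
    t |-> (f t, nu t) is differentiable and takes its values in the zero set of
    Phi_alpha. The columns of its Jacobian matrix lie in the kernel of
    DPhi_alpha and, since Df has rank e, they are independent, whence
    e + rank(DPhi_alpha) <= n + |alpha| + l ([Sol_dim_le_corank]).

    Cramer's rule controls no sign, so the multipliers nu t may leave the
    nonnegative orthant; this is harmless because the rank of DPhi_alpha is
    the same for all real multipliers. *)

Set Implicit Arguments.
Unset Strict Implicit.
Unset Printing Implicit Defensive.

(** * Polynomial maps *)

Section PolynomialCalculus.
Context {R : realType} {n : nat}.
Implicit Types (p q : mpolynomial R n) (x v : 'rV[R]_n).

Lemma grad_mul p x v :
  (v *m grad p x) 0 0 = \sum_i v 0 i * peval (mpoly.mderiv i p) x.
Proof. by rewrite mxE; apply: eq_bigr => i _; rewrite mxE. Qed.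

(** The differentiation rules make the property stable under sums and products,
    so it is enough to have it for constants and variables. *)
Lemma is_diff_peval p x : is_diff x (peval p) (fun v => (v *m grad p x) 0 0).
Proof.
have peD q r : peval (q + r) = peval q + peval r.
  by apply/funext => y; rewrite /peval mpoly.mevalD.
have peM q r : peval (q * r) = peval q * peval r.
  by apply/funext => y; rewrite /peval mpoly.mevalM.
have peC (c : R) : peval (mpoly.mpolyC n c) = cst c.
  by apply/funext => y; rewrite /peval mpoly.mevalC.
pose P q := is_diff x (peval q) (fun v => (v *m grad q x) 0 0).
have PD q r : P q -> P r -> P (q + r).
  move=> Pq Pr; rewrite /P peD; apply: (is_diff_eq (is_diffD Pq Pr)).
  apply/funext => v; rewrite !grad_mul -[LHS]/(_ + _) !grad_mul -big_split /=.
  by apply: eq_bigr => i _; rewrite mpoly.mderivD /peval mpoly.mevalD mulrDr.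
have PM q r : P q -> P r -> P (q * r).
  move=> Pq Pr; rewrite /P peM; apply: (is_diff_eq (is_diffM Pq Pr)).
  apply/funext => v; rewrite -[LHS]/(_ * _ + _ * _) !grad_mul.
  rewrite !mulr_sumr -big_split /=.
  apply: eq_bigr => i _; rewrite mpoly.mderivM /peval mpoly.mevalD !mpoly.mevalM.
  ring.
have PC (c : R) : P (mpoly.mpolyC n c).
  rewrite /P peC; apply: is_diff_eq; apply/funext => v; rewrite grad_mul.
  by rewrite big1 // => i _; rewrite mpoly.mderivC /peval mpoly.mevalC mulr0.
have PX i : P (mpoly.mpolyX R (mpoly.mnm1 i)).
  have -> : P (mpoly.mpolyX R (mpoly.mnm1 i)) =
      is_diff x (fun y : 'rV[R]_n => y 0 i : R) (fun y => y 0 i).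
    rewrite /P; congr is_diff_def.
      by apply/funext => y; rewrite /peval mpoly.mevalXU.
    apply/funext => v; rewrite grad_mul (bigD1 i) //= mpoly.mderivX.
    rewrite mpoly.mnm1E eqxx scale1r big1 => [|j ji]; last first.
      by rewrite mpoly.mderivX mpoly.mnm1E eq_sym (negPf ji) scale0r
        /peval mpoly.meval0 mulr0.
    have -> : mpoly.mnm_sub (mpoly.mnm1 i) (mpoly.mnm1 i) = mpoly.mnm0.
      by apply/mpoly.mnmP => j; rewrite mpoly.mnmBE subnn mpoly.mnm0E.
    by rewrite mpoly.mpolyX0 /peval mpoly.meval1 mulr1 addr0.
  apply: DiffDef; first exact: differentiable_coord.
  apply/funext => v; rewrite -deriveE; last exact: differentiable_coord.
  have /derivable_mxP/(_ 0 i) cd : derivable (@id 'rV[R]_n) x v.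
    exact: derivable_id.
  by rewrite -[RHS]/(v 0 i) -[in RHS](derive_id x v) derive_mx ?mxE.
have P1 : P 1 by exact: PC.
suff : P p by [].
move: p; apply: mpoly.mpolyind => [|c m p Hm Hc Pp].
  by rewrite -mpoly.mpolyC0; exact: PC.
apply: PD => //; rewrite -mpoly.mul_mpolyC; apply: (PM _ _ (PC c)).
rewrite mpoly.mpolyXE_id; apply: (big_ind P _ PM) => // i _.
by elim: (m i) => [|k IH]; rewrite ?expr0 // exprS; exact: PM.
Qed.

Lemma differentiable_peval p x : differentiable (peval p) x.
Proof. by have [] := is_diff_peval p x. Qed.

Lemma is_derive_peval_comp e (f : 'rV[R]_e -> 'rV[R]_n) (t v : 'rV[R]_e) p :
  differentiable f t ->
  is_derive t v (fun s => peval p (f s)) ((v *m 'J f t *m grad p (f t)) 0 0).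
Proof.
move=> df; have dp := differentiable_peval p (f t).
have dpf := differentiable_comp df dp.
apply: DeriveDef; first exact: diff_derivable.
rewrite (deriveE _ dpf) (diff_comp df dp) /= mul_rV_lin1.
by have [_ ->] := is_diff_peval p (f t).
Qed.

Lemma derive_peval p x i :
  'D_(delta_mx 0 i) (peval p) x = peval (mpoly.mderiv i p) x.
Proof.
rewrite deriveE; last exact: differentiable_peval.
by have [_ ->] := is_diff_peval p x; rewrite -rowE !mxE.
Qed.

(** The difference quotients of an affine function do not depend on the base
    point, so its partial derivatives are constant. *)
Lemma affine_hess p x : affine_poly p -> hess p x = 0.
Proof.
move=> [a [b pE]]; apply/matrixP => i j; rewrite !mxE.
have cst_i : peval (mpoly.mderiv i p) = cst (peval (mpoly.mderiv i p) 0).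
  apply/funext => y /=; rewrite -!derive_peval /derive.
  rewrite (_ : (fun s : R => _) =
    (fun s : R => s^-1 *: (peval p (s *: delta_mx 0 i + 0) - peval p 0))) //.
  apply/funext => s; rewrite /= !pE.
  rewrite !mulmxDl mul0mx; move: (_ *m a) (y *m a) => u w.
  by rewrite !mxE; congr (_ *: _); ring.
by rewrite -derive_peval cst_i derive_cst.
Qed.

End PolynomialCalculus.

(** * Functions with continuous partial derivatives *)

Section ContinuousPartials.
Context {R : realType}.

Lemma is_derive_line (V W : normedModType R) (f : V -> W) (y e : V) (s : R) :
  derivable f (y + s *: e) e ->
  is_derive s 1 (fun t : R => f (y + t *: e)) ('D_e f (y + s *: e)).
Proof.
have E : (fun h : R => h^-1 *: (f (h *: e + (y + s *: e)) - f (y + s *: e)))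
  = (fun h : R => h^-1 *: (f (y + (h *: (1 : R) + s) *: e) - f (y + s *: e))).
  apply/funext => h; congr (_ *: (f _ - _)).
  by rewrite [h *: 1]mulr1 scalerDl addrCA.
by move=> dfe; apply: DeriveDef; move: dfe; rewrite /derivable /derive E.
Qed.

(** The sign of c is arbitrary, so that the lemma can be used along each axis
    without orienting the segment. *)
Lemma mean_value_line (V : normedModType R) (f : V -> R) (y e : V) (c : R) :
  (forall s : R, `|s| <= `|c| -> derivable f (y + s *: e) e) ->
  exists2 s, `|s| <= `|c| & f (y + c *: e) - f y = c * 'D_e f (y + s *: e).
Proof.
move=> dfe; pose phi (t : R) : R := f (y + t *: e).
have dphi (s : R) : `|s| <= `|c| -> is_derive s 1 phi ('D_e f (y + s *: e)).
  by move=> /dfe; exact: is_derive_line.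
have mvt (a b : R) : a <= b -> (forall s : R, a <= s <= b -> `|s| <= `|c|) ->
    exists2 s, `|s| <= `|c| & phi b - phi a = 'D_e f (y + s *: e) * (b - a).
  move=> ab abc.
  have [||s] := MVT_segment (f := phi) (df := fun s => 'D_e f (y + s *: e)) ab.
  - move=> s; rewrite in_itv /= => /andP[? ?].
    by apply/dphi/abc; rewrite !ltW.
  - apply: derivable_within_continuous => s; rewrite in_itv /= => /abc sc.
    by have [] := dphi _ sc.
  - by rewrite in_itv /= => /abc sc eqn; exists s.
have phi0 : phi 0 = f y by rewrite /phi scale0r addr0.
have [c0|c0] := leP 0 c.
  have [s /andP[? ?]|s sc] := mvt _ _ c0; first by rewrite !ger0_norm.
  by rewrite phi0 subr0 mulrC => eqn; exists s.
have [s /andP[? ?]|s sc] := mvt _ _ (ltW c0).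
  by rewrite !ler0_norm ?lerN2 // ltW.
rewrite phi0 sub0r mulrN mulrC => eqn; exists s => //.
by rewrite -/(phi c) -opprB eqn opprK.
Qed.

Lemma rV_norm_le p (v : 'rV[R]_p) (c : R) :
  0 <= c -> (forall i, `|v 0 i| <= c) -> `|v| <= c.
Proof.
move=> c0 vc; rewrite [leLHS]/Num.Def.normr/= mx_normrE.
by apply: bigmax_le => // -[i j] _; rewrite ord1.
Qed.

Lemma rV_entry_le p (v : 'rV[R]_p) i : `|v 0 i| <= `|v|.
Proof.
rewrite [leRHS]/Num.Def.normr/= mx_normrE.
exact: (le_bigmax _ (fun ij : 'I_1 * 'I_p => `|v ij.1 ij.2|) (0, i)).
Qed.

(** Move from x to x + h one coordinate at a time: by the mean value theorem
    each of the p moves is the corresponding partial derivative, at a point close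
    to x, times the coordinate of h. *)
Lemma differentiable_partials p (f : 'rV[R]_p -> R) (x : 'rV[R]_p) :
  (\forall y \near x, forall i, derivable f y (delta_mx 0 i)) ->
  (forall i, {for x, continuous (fun y => 'D_(delta_mx 0 i) f y : R)}) ->
  differentiable f x.
Proof.
move=> dfx cfx; pose e i : 'rV[R]_p := delta_mx 0 i.
pose D : 'cV[R]_p := \col_i 'D_(e i) f x.
have lin_df : linear (fun v : 'rV[R]_p => (v *m D) 0 0 : R).
  by move=> a u v; rewrite mulmxDl -scalemxAl !mxE.
pose dfM := GRing.isLinear.Build _ _ _ _ _ lin_df.
pose df : {linear 'rV[R]_p -> R} := HB.pack (fun v => (v *m D) 0 0 : R) dfM.
have dfE v : df v = \sum_i v 0 i * 'D_(e i) f x.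
  by rewrite /= mxE; apply: eq_bigr => i _; rewrite mxE.
have cdf : continuous df.
  have -> : (df : _ -> _) =
      \sum_i ('D_(e i) f x \*: (fun v : 'rV[R]_p => v 0 i : R)).
    apply/funext => v; rewrite dfE fct_sumE; apply: eq_bigr => i _.
    by rewrite mulrC.
  move=> v; apply: differentiable_continuous; apply: differentiable_sum => i.
  exact/differentiableZ/differentiable_coord.
suff fo (eps : R) : 0 < eps -> \forall h \near (0 : 'rV[R]_p),
    `|f (h + x) - (f x + df h)| <= eps * `|h|.
  have dE : 'd f x = df :> (_ -> _).
    by apply: (diff_unique cdf); apply/eqaddoP => eps; exact: fo.
  apply/diff_locallyP; rewrite dE; split=> //.
  by apply/eqaddoP => eps; exact: fo.
move=> eps0.
(* One share of eps for each of the p moves; the denominator p + 1 also covers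
   p = 0. *)
pose eps' := eps / p.+1%:R.
have eps'0 : 0 < eps' by rewrite divr_gt0.
have : \forall y \near x, forall i, derivable f y (e i) /\
    `|'D_(e i) f x - 'D_(e i) f y| <= eps'.
  have cD i : \forall y \near x, `|'D_(e i) f x - 'D_(e i) f y| <= eps'.
    by have /cvgrPdist_le := cfx i; apply.
  have FcD : \forall y \near x, forall i,
    `|'D_(e i) f x - 'D_(e i) f y| <= eps'.
    exact: (@filter_forall _ 'I_p
      (fun i y => `|'D_(e i) f x - 'D_(e i) f y| <= eps') (nbhs x) _ cD).
  by near=> y => i; split; move: i; near: y.
move=> /nbhs_ballP[d /= d0 near_d].
near=> h.
have hd : `|h| < d.
  near: h; apply/nbhs_ballP; exists d => // h.
  by rewrite -ball_normE /= sub0r normrN.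
(* H k keeps the first k coordinates of h, and S k is the part of the
   differential that they account for. *)
pose H k : 'rV[R]_p := \row_j (if (j < k)%N then h 0 j else 0).
pose S k := \sum_(i < p | (i < k)%N) h 0 i * 'D_(e i) f x.
have step k : (k <= p)%N ->
    `|f (x + H k) - f x - S k| <= k%:R * eps' * `|h|.
  elim: k => [_|k IH kp].
    have -> : H 0%N = 0 by apply/rowP => j; rewrite !mxE.
    by rewrite /S big_pred0 // addr0 subrr subr0 normr0 !mul0r.
  pose i := Ordinal kp.
  have HS : H k.+1 = H k + h 0 i *: e i.
    apply/rowP => j; rewrite !mxE /= ltnS leq_eqVlt.
    have [->|ji] := eqVneq j i; first by rewrite eqxx ltnn add0r mulr1.
    have jk : (j == k :> nat) = false by apply/negbTE; move: ji; rewrite -val_eqE.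
    by rewrite jk mulr0 addr0.
  have Hin s : `|s| <= `|h 0 i| -> ball x d (x + H k + s *: e i).
    move=> sh; rewrite -ball_normE /= -addrA opprD addNKr normrN.
    apply: le_lt_trans hd; apply: rV_norm_le => // j; rewrite !mxE /=.
    have [->|ji] := eqVneq j i.
      by rewrite ltnn add0r mulr1 (le_trans sh) // rV_entry_le.
    rewrite mulr0 addr0; case: ifP => _; first exact: rV_entry_le.
    by rewrite normr0.
  have [s /Hin/near_d sh eqn] := @mean_value_line _ f (x + H k) (e i) (h 0 i)
    (fun s sh => (near_d _ (Hin s sh) i).1).
  have SS : S k.+1 = S k + h 0 i * 'D_(e i) f x.
    rewrite /S (bigD1 i) //= addrC; congr (_ + _); apply: eq_bigl => j.
    by rewrite ltnS leq_eqVlt -val_eqE /=; case: (ltngtP j k).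
  have -> : f (x + H k.+1) - f x - S k.+1 = (f (x + H k) - f x - S k) +
      h 0 i * ('D_(e i) f (x + H k + s *: e i) - 'D_(e i) f x).
    by rewrite HS SS addrA mulrBr -eqn; ring.
  rewrite -natr1 2!mulrDl (le_trans (ler_normD _ _)) // lerD ?IH 1?ltnW //.
  rewrite normrM mul1r mulrC; apply: ler_pM => //; last exact: rV_entry_le.
  by rewrite distrC; exact: (sh i).2.
have HE : H p = h by apply/rowP => j; rewrite mxE ltn_ord.
have SE : S p = df h by rewrite dfE /S; apply: eq_bigl => j; rewrite ltn_ord.
have := step p (leqnn p); rewrite HE SE => le_h.
have -> : f (h + x) - (f x + df h) = f (x + h) - f x - df h.
  by rewrite [h + x]addrC opprD addrA.
apply: le_trans le_h _; apply: ler_wpM2r => //.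
rewrite /eps' mulrCA ger_pMr // ler_pdivrMr // mul1r ler_nat.
exact: leqnSn.
Unshelve. all: by end_near. Qed.

Lemma differentiable_rV (V : normedModType R) q (f : V -> 'rV[R]_q) (x : V) :
  (forall j, differentiable (fun y => f y 0 j : R) x) -> differentiable f x.
Proof.
move=> dfx.
have -> : f = \sum_j (fun y => f y 0 j *: (delta_mx 0 j : 'rV[R]_q)).
  by apply/funext => y; rewrite fct_sumE; exact: row_sum_delta.
by apply: differentiable_sum => j; exact: differentiableZl.
Qed.

Lemma class_C1_differentiable p q (U : set 'rV[R]_p) (f : 'rV[R]_p -> 'rV[R]_q)
    (x : 'rV[R]_p) :
  open U -> class_C 1 U f -> U x -> differentiable f x.
Proof.
move=> Uop [_ Cf] Ux; apply: differentiable_rV => j.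
have Unear : \forall y \near x, U y by exact: open_nbhs_nbhs.
have dfj i y : U y -> derivable (fun y => f y 0 j : R) y (delta_mx 0 i).
  by move=> Uy; have /derivable_mxP := (Cf i).1 _ Uy; apply.
apply: differentiable_partials => [|i].
  by apply: filterS Unear => y Uy i; exact: dfj.
have -> : {for x, continuous
      (fun y => 'D_(delta_mx 0 i) (fun y => f y 0 j : R) y : R)} =
    ('D_(delta_mx 0 i) (fun y => f y 0 j : R) y @[y --> x] -->
     'D_(delta_mx 0 i) (fun y => f y 0 j : R) x) by [].
have jE y : U y ->
    'D_(delta_mx 0 i) f y 0 j = 'D_(delta_mx 0 i) (fun y => f y 0 j : R) y.
  by move=> Uy; rewrite derive_mx ?mxE //; exact: (Cf i).1.
rewrite -jE //.
apply: (@cvg_trans _ ((fun y => 'D_(delta_mx 0 i) f y 0 j : R) @ x)).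
  apply: (@near_eq_cvg _ _ (nbhs x) (nbhs_filter x)).
  by near=> y; apply: jE; near: y.
have := @continuous_comp _ _ _ ('D_(delta_mx 0 i) f)
  (fun M : 'rV[R]_q => M 0 j) x ((Cf i).2.1 _ Ux).
apply; exact: coord_continuous.
Unshelve. all: by end_near. Qed.

End ContinuousPartials.

(** * Semicontinuity and density *)

Section Topology.

(** A point where r is maximal will do; the bound N makes the maximum exist. *)
Lemma lsc_locally_constant (T : topologicalType) (V : set T) (r : T -> nat) N :
  V !=set0 -> (forall t, V t -> (r t <= N)%N) ->
  open V -> (forall t, V t -> \forall s \near t, (r t <= r s)%N) ->
  exists2 t, V t & \forall s \near t, r s = r t.
Proof.
move=> [t0 Vt0] rN Vop lsc.
pose P k := `[< exists2 t, V t & r t = k >].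
have exP : exists k, P k by exists (r t0); apply/asboolP; exists t0.
have PN k : P k -> (k <= N)%N by move=> /asboolP[t Vt <-]; exact: rN.
have [k /asboolP[t Vt rt] kmax] := ex_maxnP exP PN.
exists t => //; have Vn : \forall s \near t, V s by exact: open_nbhs_nbhs.
apply: filterS2 Vn (lsc t Vt) => s Vs rts; apply/eqP.
by rewrite eqn_leq rts rt kmax //; apply/asboolP; exists s.
Qed.

(** A finite union of nowhere dense sets is nowhere dense: an open subset of V
    that avoids the last set is covered by the others. *)
Lemma finite_cover_somewhere_dense (T : topologicalType) N (A : 'I_N -> set T)
    (V : set T) :
  open V -> V !=set0 -> V `<=` \bigcup_i A i ->
  exists i V', [/\ open V', V' !=set0, V' `<=` V &
    forall O, open O -> O !=set0 -> O `<=` V' -> O `&` A i !=set0].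
Proof.
elim: N A V => [|N IH] A V Vop V0 VA.
  by have [t /VA[[]]] := V0.
have [dense|] := pselect (forall O, open O -> O !=set0 -> O `<=` V ->
    O `&` A ord_max !=set0).
  by exists ord_max, V; split.
move=> /existsNP[ O] /not_implyP[ Oop] /not_implyP[ O0] /not_implyP[ OV].
move=> /nonemptyPn OA.
have [|i [V' [V'op V'0 V'O V'A]]] :=
    IH (fun i => A (widen_ord (leqnSn N) i)) O Oop O0.
  move=> t Ot; have [i _ Ait] := VA t (OV t Ot).
  have [iN|iN] := eqVneq i ord_max.
    suff: (O `&` A ord_max) t by rewrite OA.
    by split=> //; rewrite -iN.
  have iN' : (i < N)%N.
    by rewrite ltn_neqAle -ltnS ltn_ord andbT; move: iN; rewrite -val_eqE.
  by exists (Ordinal iN') => //; rewrite (_ : widen_ord _ _ = i) //; exact/val_inj.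
by exists (widen_ord (leqnSn N) i), V'; split=> // t /V'O /OV.
Qed.

End Topology.

(** * Smooth charts and dimension *)

Section Charts.
Context {R : realType}.

Lemma near_eq_differentiable (V W : normedModType R) (f g : V -> W) (x : V) :
  (\forall y \near x, f y = g y) -> differentiable f x -> is_diff x g ('d f x).
Proof.
move=> fg /diff_locallyP[dfc fE].
suff gE : g \o shift x = cst (g x) + 'd f x +o_ 0 id.
  have dg := diff_unique dfc gE.
  by apply: DiffDef => //; apply/diff_locallyP; rewrite dg.
apply/eqaddoP => eps eps0; have /eqaddoP/(_ eps eps0) := fE.
move=> fle; have fg0 : \forall h \near 0, f (h + x) = g (h + x).
  by rewrite (near_shift x) /=; near do rewrite /= sub0r addrNK.
near=> h.
rewrite -[X in `|X|]/(g (h + x) - (g x + 'd f x h)) -(nbhs_singleton fg).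
by rewrite -(near fg0 h) //; near: h.
Unshelve. all: by end_near. Qed.

(** The chain rule exhibits a right inverse of the Jacobian matrix of phi. *)
Lemma jacobian_rank_left_inverse e d (phi : 'rV[R]_e -> 'rV[R]_d)
    (chi : 'rV[R]_d -> 'rV[R]_e) (t : 'rV[R]_e) :
  differentiable phi t -> differentiable chi (phi t) ->
  (\forall s \near t, chi (phi s) = s) -> \rank ('J phi t) = e.
Proof.
move=> dphi dchi chiK; have dc := differentiable_comp dphi dchi.
have [_ did] := near_eq_differentiable chiK dc.
have dE v : 'd chi (phi t) ('d phi t v) = v.
  have -> : 'd chi (phi t) ('d phi t v) = 'd (chi \o phi) t v.
    by rewrite (diff_comp dphi dchi).
  by rewrite -did diff_val.
have J1 : 'J phi t *m 'J chi (phi t) = 1%:M.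
  by apply/row_matrixP => i; rewrite rowE mulmxA !mul_rV_lin1 dE rowE mulmx1.
apply/eqP; rewrite eqn_leq rank_leq_row -[leqLHS](mxrank1 R) -J1.
exact: mxrankM_maxl.
Qed.

Lemma open_cube_open d : open (@open_cube R d).
Proof.
rewrite openE => t tcube.
have ci (i : 'I_d) : nbhs (t : 'rV[R]_d) [set s : 'rV[R]_d | 0 < s 0 i < 1].
  have := @coord_continuous R 1 d 0 i t.
  move=> /(_ [set r : R | 0 < r < 1]); apply.
  apply: open_nbhs_nbhs; split; last exact: tcube.
  have -> : [set r : R | 0 < r < 1] = `]0, 1[%classic.
    by apply/seteqP; split => r /=; rewrite in_itv.
  exact: interval_open.
exact: (@filter_forall _ 'I_d (fun i (s : 'rV[R]_d) => 0 < s 0 i < 1) (nbhs t) _ ci).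
Qed.

Lemma smooth_on_ext p q (A : set 'rV[R]_p) (f : 'rV[R]_p -> 'rV[R]_q) x :
  smooth_on A f -> A x -> exists U f', [/\ open U, U x,
    forall y, U y -> differentiable f' y & forall y, A y -> U y -> f' y = f y].
Proof.
move=> sf Ax; have [U [f' [Uop Ux f'C f'f]]] := sf x Ax.
by exists U, f'; split=> // y; exact: class_C1_differentiable.
Qed.

Lemma smooth_on_open p q (A : set 'rV[R]_p) (f : 'rV[R]_p -> 'rV[R]_q) x :
  open A -> smooth_on A f -> A x -> differentiable f x.
Proof.
move=> Aop sf Ax; have [U [f' [Uop Ux df' f'f]]] := smooth_on_ext sf Ax.
have f'n : \forall y \near x, f' y = f y.
  have An : \forall y \near x, A y by exact: open_nbhs_nbhs.
  have Un : \forall y \near x, U y by exact: open_nbhs_nbhs.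
  by apply: filterS2 An Un.
by have [] := near_eq_differentiable f'n (df' x Ux).
Qed.

Variables (e n : nat) (C : set 'rV[R]_n) (f : 'rV[R]_e -> 'rV[R]_n).
Hypothesis chart : semialgebraic_diffeo (@open_cube R e) C f.

Lemma chart_differentiable t : open_cube t -> differentiable f t.
Proof.
by have [_ _ sf _] := chart; apply: smooth_on_open sf; exact: open_cube_open.
Qed.

Lemma chart_continuous t : open_cube t -> {for t, continuous f}.
Proof. by move=> /chart_differentiable/differentiable_continuous. Qed.

(** The inverse of a chart is smooth on a set that need not be open; only its
    local extension G can be differentiated in all directions. *)
Lemma chart_local_inverse t : open_cube t -> exists U G,
  [/\ open U, U (f t), forall y, U y -> differentiable G y &
      forall s, open_cube s -> U (f s) -> G (f s) = s].
Proof.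
have [[fC _ _] _ _ [f' f'K sf']] := chart => tcube.
have [U [G [Uop Uft dG Gf']]] := smooth_on_ext sf' (fC t tcube).
exists U, G; split=> // s scube Ufs.
by rewrite Gf' //; [exact: f'K | exact: fC].
Qed.

Lemma chart_rank t : open_cube t -> \rank ('J f t) = e.
Proof.
move=> tcube; have [U [G [Uop Uft dG Gf]]] := chart_local_inverse tcube.
apply: jacobian_rank_left_inverse (dG _ Uft) _.
  exact: chart_differentiable.
have cn : \forall s \near t, open_cube s.
  by apply: open_nbhs_nbhs; split=> //; exact: open_cube_open.
have Un : \forall s \near t, U (f s).
  by apply: (chart_continuous tcube); exact: open_nbhs_nbhs.
by apply: filterS2 cn Un.
Qed.

End Charts.

Section Dimension.
Context {R : realType}.

(** Let phi be the composite of f with the inverse of psi, locally extended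
    around a point of D. It satisfies psi o phi = f on f^-1(D), hence by density
    on a neighbourhood of the point; composing with a local left inverse of f,
    phi has a left inverse and its Jacobian matrix, which has d columns, has
    rank e. *)
Lemma chart_dim_le_dense e d n (C D : set 'rV[R]_n)
    (f : 'rV[R]_e -> 'rV[R]_n) (psi : 'rV[R]_d -> 'rV[R]_n) (V : set 'rV[R]_e) :
  semialgebraic_diffeo (@open_cube R e) C f ->
  semialgebraic_diffeo (@open_cube R d) D psi ->
  open V -> V !=set0 -> V `<=` @open_cube R e ->
  (forall O, open O -> O !=set0 -> O `<=` V -> O `&` (f @^-1` D) !=set0) ->
  (e <= d)%N.
Proof.
move=> fchart psichart Vop V0 Vcube dense.
have [t [Vt Dft]] := dense V Vop V0 (fun t Vt => Vt).
have [[_ _ psisurj] _ _ _] := psichart.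
have [u ucube psiu] := psisurj _ Dft.
have [U [H [Uop + dH HK]]] := chart_local_inverse psichart ucube.
rewrite psiu => Uft.
pose phi := H \o f.
have phit : phi t = u by rewrite /phi /= -psiu HK // psiu.
have dphi s : V s -> U (f s) -> differentiable phi s.
  move=> Vs Ufs; apply: differentiable_comp; last exact: dH.
  exact: chart_differentiable fchart _ (Vcube _ Vs).
have cf s : V s -> {for s, continuous f}.
  by move=> Vs; exact: chart_continuous fchart _ (Vcube _ Vs).
have nearU s : V s -> U (f s) -> \forall s' \near s, V s' /\ U (f s').
  move=> Vs Ufs; have Vn : \forall s' \near s, V s' by exact: open_nbhs_nbhs.
  have Un : \forall s' \near s, U (f s').
    by apply: (cf s Vs); exact: open_nbhs_nbhs.
  by apply: filterS2 Vn Un.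
(* V' is open and contains t; psi o phi is defined and continuous on it. *)
pose V' := [set s | [/\ V s, U (f s) & open_cube (phi s)]].
have V'near s : V' s -> \forall s' \near s, V' s'.
  move=> [Vs Ufs cs].
  have cn : \forall s' \near s, open_cube (phi s').
    apply: (differentiable_continuous (dphi s Vs Ufs)).
    by apply: open_nbhs_nbhs; split=> //; exact: open_cube_open.
  by apply: filterS2 (nearU s Vs Ufs) cn => s' [].
have V't : V' t by split=> //; rewrite phit.
have psiphi s : V' s -> psi (phi s) = f s.
  move=> V's; have [Vs Ufs cs] := V's; apply/eqP/negPn/negP => neq.
  pose gap s' := psi (phi s') - f s'.
  have cgap s' : V' s' -> {for s', continuous gap}.
    move=> [Vs' Ufs' cs']; apply: continuousB; last exact: cf.
    apply: continuous_comp; last exact: chart_continuous psichart _ cs'.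
    exact: differentiable_continuous (dphi _ Vs' Ufs').
  pose O := [set s' | V' s' /\ gap s' != 0].
  have Oop : open O.
    rewrite openE => s' [V's' gs'].
    have gn : \forall s'' \near s', gap s'' != 0.
      apply: (cgap s' V's' [set y | y != 0]); apply: open_nbhs_nbhs; split=> //.
      have -> : [set y : 'rV[R]_n | y != 0] = ~` [set 0].
        by apply/seteqP; split => y /= /eqP.
      apply: closed_openC; apply: accessible_closed_set1.
      by apply: hausdorff_accessible; exact: norm_hausdorff.
    by apply: filterS2 (V'near s' V's') gn.
  have OV : O `<=` V by move=> s' [[]].
  have [|s' [[[Vs' Ufs' cs'] /eqP gs'] Dfs']] := dense O Oop _ OV.
    by exists s; split=> //; rewrite subr_eq0.
  have [u' u'cube psiu'] := psisurj _ Dfs'.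
  by apply: gs'; rewrite /gap /phi /= -psiu' HK ?psiu' ?subrr.
have [U' [G [U'op U'ft dG Gf]]] := chart_local_inverse fchart (Vcube t Vt).
have dG' : differentiable (G \o psi) (phi t).
  apply: differentiable_comp.
    by apply: (chart_differentiable psichart); rewrite phit.
  by rewrite psiphi //; exact: dG.
have id_near : \forall s \near t, (G \o psi) (phi s) = s.
  have U'n : \forall s \near t, U' (f s).
    by apply: (cf t Vt); exact: open_nbhs_nbhs.
  apply: filterS2 (V'near t V't) U'n => s V's U'fs.
  by rewrite /= psiphi // Gf //; case: V's => /Vcube.
by rewrite -(jacobian_rank_left_inverse (dphi t Vt Uft) dG' id_near)
  rank_leq_col.
Qed.

Lemma chart_dim_le_cover e n (C K : set 'rV[R]_n) (d : \bar int)
    (f : 'rV[R]_e -> 'rV[R]_n) (V : set 'rV[R]_e) :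
  semialgebraic_diffeo (@open_cube R e) C f -> has_dim K d ->
  open V -> V !=set0 -> V `<=` @open_cube R e -> f @` V `<=` K ->
  (e%:Z%:E <= d)%E.
Proof.
move=> fchart [N [D [dD [[KE _ _ Dchart] ->]]]] Vop V0 Vcube fVK.
have [|i [V' [V'op V'0 V'V dense]]] :=
    @finite_cover_somewhere_dense _ N (fun i => f @^-1` D i) V Vop V0.
  by move=> t Vt; have := fVK _ (imageP f Vt); rewrite KE => -[i _ ?]; exists i.
have [psi psichart] := Dchart i.
have ed := chart_dim_le_dense fchart psichart V'op V'0
  (fun t V't => Vcube t (V'V t V't)) dense.
by apply: le_trans (le_bigmax _ _ i); rewrite lee_fin lez_nat.
Qed.

End Dimension.

(** * Linear systems with parameters *)

Section ParametricLinearSystem.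
Context {R : realType} {V : normedModType R}.
Implicit Types t : V.

Lemma differentiable_bigsum (I : Type) (r : seq I) (P : pred I)
    (f : I -> V -> R) t :
  (forall i, differentiable (f i) t) ->
  differentiable (fun s => \sum_(i <- r | P i) f i s) t.
Proof.
move=> df; elim: r => [|i r IH].
  by under eq_fun do rewrite big_nil; exact: differentiable_cst.
under eq_fun do rewrite big_cons; case: (P i) => //.
exact: differentiableD.
Qed.

Lemma differentiable_bigprod (I : Type) (r : seq I) (P : pred I)
    (f : I -> V -> R) t :
  (forall i, differentiable (f i) t) ->
  differentiable (fun s => \prod_(i <- r | P i) f i s) t.
Proof.
move=> df; elim: r => [|i r IH].
  by under eq_fun do rewrite big_nil; exact: differentiable_cst.
under eq_fun do rewrite big_cons; case: (P i) => //.
exact: differentiableM.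
Qed.

Definition differentiable_entries m n (A : V -> 'M[R]_(m, n)) t :=
  forall i j, differentiable (fun s => A s i j : R) t.

Lemma differentiable_entries_cst m n (A : 'M[R]_(m, n)) t :
  differentiable_entries (fun=> A) t.
Proof. by move=> i j; exact: differentiable_cst. Qed.

Lemma differentiable_entries_mulmx m n p (A : V -> 'M[R]_(m, n))
    (B : V -> 'M[R]_(n, p)) t :
  differentiable_entries A t -> differentiable_entries B t ->
  differentiable_entries (fun s => A s *m B s) t.
Proof.
move=> dA dB i j; under eq_fun do rewrite mxE.
by apply: differentiable_bigsum => k; exact: differentiableM.
Qed.

Lemma differentiable_det n (A : V -> 'M[R]_n) t :
  differentiable_entries A t -> differentiable (fun s => \det (A s)) t.
Proof.
move=> dA; apply: differentiable_bigsum => sigma.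
apply: differentiableM; first exact: differentiable_cst.
exact: differentiable_bigprod.
Qed.

Lemma differentiable_entries_adj n (A : V -> 'M[R]_n) t :
  differentiable_entries A t -> differentiable_entries (fun s => \adj (A s)) t.
Proof.
move=> dA i j; under eq_fun do rewrite mxE.
apply: differentiableM; first exact: differentiable_cst.
apply: differentiable_det => i' j'; under eq_fun do rewrite !mxE.
exact: dA.
Qed.

Lemma near_neq0 (f : V -> R) t :
  differentiable f t -> f t != 0 -> \forall s \near t, f s != 0.
Proof.
move=> /differentiable_continuous cf ft0.
apply: (cf [set y | y != 0]); apply: open_nbhs_nbhs; split=> //; exact: open_neq.
Qed.

(** An invertible submatrix of maximal size, up to a change of coordinates. *)
Lemma rank_minor m n (A : 'M[R]_(m, n)) :
  exists (L : 'M[R]_(\rank A, m)) (Q : 'M[R]_(n, \rank A)), L *m A *m Q = 1%:M.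
Proof.
have /row_fullP[L LA] := col_base_full A.
have /row_freeP[Q AQ] := row_base_free A.
exists L, Q; have -> : L *m A = row_base A.
  have := congr1 (mulmx L) (mulmx_base A).
  by rewrite mulmxA LA mul1mx.
exact: AQ.
Qed.

(** The determinant of the maximal minor L *m A s *m Q, equal to 1 at t, stays
    nonzero nearby. *)
Lemma rank_lsc m n (A : V -> 'M[R]_(m, n)) t :
  differentiable_entries A t -> \forall s \near t, (\rank (A t) <= \rank (A s))%N.
Proof.
move=> dA; have [L [Q LAQ]] := rank_minor (A t).
have dB : differentiable_entries (fun s => L *m A s *m Q) t.
  apply: differentiable_entries_mulmx; last exact: differentiable_entries_cst.
  by apply: differentiable_entries_mulmx => //; exact: differentiable_entries_cst.
have detB : \det (L *m A t *m Q) != 0 by rewrite LAQ det1 oner_eq0.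
apply: filterS (near_neq0 (differentiable_det dB) detB) => s detBs.
have : (L *m A s *m Q) \in unitmx by rewrite unitmxE unitfE.
rewrite -row_free_unit -row_leq_rank => /leq_trans; apply.
exact: leq_trans (mxrankM_maxl _ _) (mxrankM_maxr _ _).
Qed.

(** As the rank does not jump, near t the columns of A s *m Q span those of A s,
    so the solution may be sought in the form Q *m w. Such a w solves the square
    invertible system with matrix B s = L *m A s *m Q, and Cramer's rule
    expresses it by the entries of A and b. *)
Lemma differentiable_solution m n (A : V -> 'M[R]_(m, n)) (b : V -> 'cV[R]_m) t :
  differentiable_entries A t -> differentiable_entries b t ->
  (\forall s \near t, \rank (A s) = \rank (A t)) ->
  (\forall s \near t, exists x, A s *m x = b s) ->
  exists2 x : V -> 'cV[R]_n,
    differentiable_entries x t & \forall s \near t, A s *m x s = b s.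
Proof.
move=> dA db rankA solvable; have [L [Q LAQ]] := rank_minor (A t).
pose B s := L *m A s *m Q.
have dB : differentiable_entries B t.
  apply: differentiable_entries_mulmx; last exact: differentiable_entries_cst.
  by apply: differentiable_entries_mulmx => //; exact: differentiable_entries_cst.
have dL : differentiable_entries (fun s => L *m b s) t.
  by apply: differentiable_entries_mulmx => //; exact: differentiable_entries_cst.
have detBt : \det (B t) != 0 by rewrite /B LAQ det1 oner_eq0.
exists (fun s => (\det (B s))^-1 *: (Q *m (\adj (B s) *m (L *m b s)))).
  move=> i j; under eq_fun do rewrite mxE.
  apply: differentiableM.
    by apply: differentiableV => //; exact: differentiable_det.
  apply: differentiable_entries_mulmx; first exact: differentiable_entries_cst.
  by apply: differentiable_entries_mulmx => //; exact: differentiable_entries_adj.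
apply: filterS3 (near_neq0 (differentiable_det dB) detBt) rankA solvable.
move=> s detBs rankAs [x Ax].
have Bunit : B s \in unitmx by rewrite unitmxE unitfE.
have sub : ((A s *m Q)^T <= (A s)^T)%MS by rewrite trmx_mul submxMl.
have : ((A s)^T <= (A s *m Q)^T)%MS.
  rewrite -(geq_leqif (mxrank_leqif_sup sub)) !mxrank_tr rankAs.
  move: Bunit; rewrite -row_free_unit -row_leq_rank => /leq_trans; apply.
  by rewrite /B -mulmxA mxrankM_maxr.
move=> /submxP[D /(congr1 trmx)]; rewrite trmxK trmx_mul trmxK => AE.
have bE : b s = A s *m Q *m (D^T *m x) by rewrite mulmxA -AE.
have LbE : L *m b s = B s *m (D^T *m x) by rewrite bE /B !mulmxA.
have -> : \adj (B s) *m (L *m b s) = \det (B s) *: (D^T *m x).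
  by rewrite LbE mulmxA mul_adj_mx mul_scalar_mx.
by rewrite -!scalemxAr scalerA mulVf // scale1r bE mulmxA.
Qed.

End ParametricLinearSystem.

(** * Multipliers along the solution set *)

Section KKT.
Context {R : realType} {n m l : nat}.
Variables (F : 'I_n -> mpolynomial R n).
Variables (g : 'I_m -> mpolynomial R n) (h : 'I_l -> mpolynomial R n).
Implicit Types (x v : 'rV[R]_n) (alpha : {set 'I_m}).

(** The last block column of the first block row of [DPhi]. *)
Definition active_grads alpha x : 'M[R]_(n, #|alpha| + l) :=
  row_mx (grad_g g alpha x) (grad_h h x).

Lemma Sol_tangent_cone (K : set 'rV[R]_n) x v :
  Sol F K x -> tangent_cone K x v -> 0 <= (poly_map F x *m v^T) 0 0.
Proof.
move=> [_ solx] [y [t [Ky t0 _ _ yv]]].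
pose c (w : 'rV[R]_n) : R := (poly_map F x *m w^T) 0 0.
have cc : continuous c.
  move=> w; apply: differentiable_continuous; rewrite /c.
  under eq_fun do rewrite mxE.
  apply: differentiable_bigsum => k.
  apply: differentiableM; first exact: differentiable_cst.
  by under eq_fun do rewrite mxE; exact: differentiable_coord.
rewrite leNgt; apply/negP => cv0.
have cv_lt0 : nbhs v [set w | c w < 0].
  apply: (cc v [set a : R | a < 0]); apply: open_nbhs_nbhs; split=> //.
have yv_lt0 : \forall k \near \oo, c ((t k)^-1 *: (y k - x)) < 0.
  exact: yv cv_lt0.
have [k cyk] := filter_ex yv_lt0.
suff : 0 <= c ((t k)^-1 *: (y k - x)) by rewrite leNgt cyk.
rewrite /c linearZ /= -scalemxAr mxE mulr_ge0 //; first by rewrite invr_ge0 ltW.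
exact: (solx _ (Ky k)).
Qed.

(** A vector v orthogonal to all the active gradients lies in the linearized cone
    together with - v. By the qualification condition both are tangent to K, so
    the variational inequality forces F x to be orthogonal to v: F x is in the
    biorthogonal, that is the span, of the active gradients. *)
Lemma KKT_span alpha x :
  Sol F (feasible_set g h) x -> pseudo_face g h alpha x -> ACQ g h x ->
  exists nu, active_grads alpha x *m nu = - (poly_map F x)^T.
Proof.
move=> solx [ga gna hx] acq.
suff : (poly_map F x <= (active_grads alpha x)^T)%MS.
  move=> /submxP[D FD]; exists (- D^T).
  by rewrite mulmxN FD trmx_mul trmxK.
rewrite submxE; apply/eqP/rowP => j; rewrite [RHS]mxE.
pose v := (col j (cokermx (active_grads alpha x)^T))^T.
have lineality : v *m active_grads alpha x = 0.
  apply: trmx_inj; rewrite trmx_mul /v trmxK colE.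
  by rewrite mulmxA mulmx_coker mul0mx trmx0.
have vg (k : 'I_#|alpha|) : (v *m grad (g (enum_val k)) x) 0 0 = 0.
  have := congr1 (fun M => lsubmx M 0 k) lineality.
  rewrite mul_mx_row row_mxKl linear0 !mxE => E; rewrite -[RHS]E.
  by apply: eq_bigr => i _; rewrite !mxE.
have vh j' : (v *m grad (h j') x) 0 0 = 0.
  have := congr1 (fun M => rsubmx M 0 j') lineality.
  rewrite mul_mx_row row_mxKr linear0 !mxE => E; rewrite -[RHS]E.
  by apply: eq_bigr => i _; rewrite !mxE.
have vL (s : R) : linearized_cone g h x (s *: v).
  split=> [i gi0|j']; last by rewrite -scalemxAl mxE vh mulr0.
  have ia : i \in alpha.
    by apply/negPn/negP => /gna; rewrite gi0 ltxx.
  by rewrite -(enum_rankK_in ia ia) -scalemxAl mxE vg mulr0.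
have Fv (s : R) : 0 <= s * (poly_map F x *m v^T) 0 0.
  have := vL s; rewrite acq => /(Sol_tangent_cone solx).
  by rewrite linearZ /= -scalemxAr mxE.
have : (poly_map F x *m v^T) 0 0 = 0.
  apply/eqP; rewrite eq_le -oppr_ge0 -mulN1r Fv /=.
  by have := Fv 1; rewrite mul1r.
by rewrite /v trmxK colE mulmxA -colE mxE.
Qed.

(** Differentiating the equations F + A nu = 0, g_alpha = 0 and h = 0 along
    s |-> (f s, nu s) at t gives DPhi *m Z = 0, where Z stacks the Jacobian
    matrices of f and nu. The rank of Z is e because that of 'J f t is, and the
    ranks of two matrices whose product vanishes add up to at most their common
    dimension. *)
Lemma Sol_dim_le_corank e alpha (f : 'rV[R]_e -> 'rV[R]_n) (V : set 'rV[R]_e) r :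
  open V -> V !=set0 ->
  (forall t, V t -> differentiable f t) -> (forall t, V t -> \rank ('J f t) = e) ->
  (forall t, V t -> pseudo_face g h alpha (f t)) ->
  (forall t, V t -> exists nu,
    active_grads alpha (f t) *m nu = - (poly_map F (f t))^T) ->
  (forall j, affine_poly (h j)) ->
  (forall x (lambda : 'rV[R]_#|alpha|), \rank (DPhi F g h x lambda) = r) ->
  (e + r <= n + #|alpha| + l)%N.
Proof.
move=> Vop V0 df Jf fface kkt h_affine rankD.
pose A s := active_grads alpha (f s); pose b s := - (poly_map F (f s))^T.
have dpf p t : V t -> differentiable (fun s => peval p (f s)) t.
  move=> Vt; apply: differentiable_comp; first exact: df.
  exact: differentiable_peval.
have dA t : V t -> differentiable_entries A t.
  move=> Vt i k; case: (split_ordP k) => k' ->.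
    by under eq_fun do rewrite row_mxEl !mxE; exact: dpf.
  by under eq_fun do rewrite row_mxEr !mxE; exact: dpf.
have db t : V t -> differentiable_entries b t.
  move=> Vt i k; under eq_fun do rewrite !mxE.
  exact/differentiableN/dpf.
have [t Vt rankA] := @lsc_locally_constant _ V (fun s => \rank (A s)) n V0
  (fun s _ => rank_leq_row (A s)) Vop (fun s Vs => rank_lsc (dA s Vs)).
have Vn : \forall s \near t, V s by exact: open_nbhs_nbhs.
have [nu dnu nuE] := differentiable_solution
  (dA t Vt) (db t Vt) rankA (filterS kkt Vn).
pose lambda : 'rV[R]_#|alpha| := \row_k nu t (lshift l k) 0.
pose W : 'M[R]_(#|alpha| + l, e) :=
  \matrix_(k, i) 'D_(delta_mx 0 i) (fun s => nu s k 0 : R) t.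
have Z0 : DPhi F g h (f t) lambda *m col_mx ('J f t)^T W = 0.
  rewrite /DPhi mul_block_col mul0mx addr0.
  have -> : col_mx (grad_g g alpha (f t))^T (grad_h h (f t))^T *m ('J f t)^T = 0.
    have J0 p : (forall s, V s -> peval p (f s) = 0) -> 'J f t *m grad p (f t) = 0.
      move=> pf0; apply/colP => i; rewrite [RHS]mxE.
      have d1 := is_derive_peval_comp (delta_mx 0 i) p (df t Vt).
      have pn : \forall s \near t, 0 = peval p (f s).
        by apply: filterS Vn => s Vs; rewrite pf0.
      have d0 := near_eq_is_derive pn (is_derive_cst (0 : R) t (delta_mx 0 i)).
      have := @derive_val _ _ _ _ _ _ _ d1; rewrite (@derive_val _ _ _ _ _ _ _ d0).
      by rewrite -mulmxA -rowE mxE => <-.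
    have JA : 'J f t *m A t = 0.
      apply/matrixP => i k; rewrite [RHS]mxE mxE.
      case: (split_ordP k) => k' ->.
        have /J0/matrixP/(_ i 0) : forall s, V s ->
            peval (g (enum_val k')) (f s) = 0.
          by move=> s /fface[ga _ _]; exact: (ga _ (enum_valP k')).
        rewrite !mxE => Jg; rewrite -[RHS]Jg; apply: eq_bigr => c _.
        by rewrite row_mxEl !mxE.
      have /J0/matrixP/(_ i 0) : forall s, V s -> peval (h k') (f s) = 0.
        by move=> s /fface[_ _]; apply.
      rewrite !mxE => Jh; rewrite -[RHS]Jh; apply: eq_bigr => c _.
      by rewrite row_mxEr !mxE.
    by rewrite -tr_row_mx -trmx_mul JA trmx0.
  rewrite -[RHS]col_mx0; congr col_mx.
  apply/matrixP => a i; rewrite [RHS]mxE.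
  pose v : 'rV[R]_e := delta_mx 0 i.
  pose dAa k := 'D_v (fun s => A s a k : R) t.
  have JE p : (v *m 'J f t *m grad p (f t)) 0 0 =
      \sum_c 'J f t i c * peval (mpoly.mderiv c p) (f t).
    by rewrite -rowE mxE; apply: eq_bigr => c _; rewrite !mxE.
  have dAl k : dAa (lshift l k) =
      \sum_c 'J f t i c * hess (g (enum_val k)) (f t) a c.
    rewrite /dAa; under eq_fun do rewrite row_mxEl !mxE.
    rewrite (@derive_val _ _ _ _ _ _ _ (is_derive_peval_comp _ _ (df t Vt))) JE.
    by apply: eq_bigr => c _; rewrite [hess _ _ _ _]mxE.
  have dAr j : dAa (rshift #|alpha| j) = 0.
    rewrite /dAa; under eq_fun do rewrite row_mxEr !mxE.
    rewrite (@derive_val _ _ _ _ _ _ _ (is_derive_peval_comp _ _ (df t Vt))) JE.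
    apply: big1 => c _; have /matrixP/(_ a c) := affine_hess (f t) (h_affine j).
    by rewrite !mxE => ->; rewrite mulr0.
  (* The derivative in the i-th direction of the a-th line of F + A nu = 0. *)
  have dsys : \sum_k (A t a k * W k i + nu t k 0 * dAa k) +
      \sum_c 'J f t i c * jacF F (f t) a c = 0.
    have dterm k : is_derive t v ((fun s => A s a k : R) * (fun s => nu s k 0 : R))
        (A t a k * W k i + nu t k 0 * dAa k).
      have -> : W k i = 'D_v (fun s => nu s k 0 : R) t by rewrite mxE.
      apply: is_deriveM; apply: derivableP; apply: diff_derivable.
        exact: dA.
      exact: dnu.
    have dsum := is_deriveD (is_derive_sum dterm)
      (is_derive_peval_comp v (F a) (df t Vt)).
    have sys0 : \forall s \near t, 0 =
        (\sum_k ((fun s => A s a k : R) * (fun s => nu s k 0 : R)) +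
         (fun s => peval (F a) (f s))) s.
      apply: filterS nuE => s /matrixP/(_ a 0).
      rewrite !mxE => nusE.
      rewrite -[RHS]/(_ s + peval (F a) (f s)) fct_sumE.
      by rewrite [X in X + _](_ : _ = - peval (F a) (f s)) ?addNr // -nusE.
    have d0 := near_eq_is_derive sys0 (is_derive_cst (0 : R) t v).
    have := @derive_val _ _ _ _ _ _ _ dsum.
    rewrite (@derive_val _ _ _ _ _ _ _ d0) JE => dE; rewrite [RHS]dE.
    by congr (_ + _); apply: eq_bigr => c _; rewrite [jacF _ _ _ _]mxE.
  rewrite mxE [X in X + _]mxE [X in _ + X]mxE -[RHS]dsys.
  rewrite big_split /= -addrA [LHS]addrC.
  congr (_ + _).
  rewrite big_split_ord /= [X in _ = _ + X + _]big1 ?addr0 => [|j _]; last first.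
    by rewrite dAr mulr0.
  transitivity (\sum_c ('J f t i c * jacF F (f t) a c +
      \sum_k lambda 0 k * ('J f t i c * hess (g (enum_val k)) (f t) a c))).
    apply: eq_bigr => c _; rewrite [_^T _ _]mxE mulrC [X in _ * X]mxE mulrDr.
    congr (_ + _); rewrite summxE mulr_sumr; apply: eq_bigr => k _.
    by rewrite [(_ *: hess _ _) _ _]mxE mulrCA.
  rewrite big_split /= addrC exchange_big /=; congr (_ + _).
  apply: eq_bigr => k _; rewrite dAl mulr_sumr; apply: eq_bigr => c _.
  by rewrite [lambda _ _]mxE.
have := mulmx0_rank_max Z0.
have -> : \rank (col_mx ('J f t)^T W) = e.
  apply/eqP; rewrite eqn_leq rank_leq_col -[leqLHS](Jf t Vt) -mxrank_tr.
  by apply: mxrankS; rewrite -addsmxE addsmxSl.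
by rewrite rankD addnC addnA.
Qed.

End KKT.

(** * The dimension of the solution set *)

Section Cells.
Context {R : realType} {n m l : nat}.
Variables (g : 'I_m -> mpolynomial R n) (h : 'I_l -> mpolynomial R n).

(** The set I t of the inactive constraints can only grow near t; it is therefore
    locally constant where its cardinal is. *)
Lemma locally_in_pseudo_face e (f : 'rV[R]_e -> 'rV[R]_n) (U : set 'rV[R]_e) :
  open U -> U !=set0 -> (forall t, U t -> {for t, continuous f}) ->
  (forall t, U t -> feasible_set g h (f t)) ->
  exists alpha V, [/\ open V, V !=set0, V `<=` U &
    forall t, V t -> pseudo_face g h alpha (f t)].
Proof.
move=> Uop U0 cf fK; pose I t := [set i | peval (g i) (f t) < 0]%SET.
have I_stable t : U t -> \forall s \near t, I t \subset I s.
  move=> Ut.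
  have stable_i i : nbhs t [set s | i \in I t -> i \in I s].
    have [|it] := boolP (i \in I t); last exact: filterE.
    rewrite inE => it.
    have cg : {for t, continuous (fun s => peval (g i) (f s) : R)}.
      apply: continuous_comp; first exact: cf.
      exact/differentiable_continuous/differentiable_peval.
    have : \forall s \near t, peval (g i) (f s) < 0.
      apply: (cg [set a : R | a < 0]); apply: open_nbhs_nbhs; split.
        exact: open_lt.
      exact: it.
    by apply: filterS => s si _; rewrite inE.
  have sub_t : \forall s \near t, forall i, i \in I t -> i \in I s.
    exact: (@filter_forall _ _ (fun i s => i \in I t -> i \in I s) (nbhs t) _ stable_i).
  by apply: filterS sub_t => s sub; apply/fintype.subsetP.
have [t Ut cardI] := @lsc_locally_constant _ U (fun s => #|I s|) m U0
  (fun s _ => leq_trans (max_card _) (eq_leq (card_ord m))) Uop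
  (fun s Us => filterS (fun s' => @subset_leq_card _ _ _) (I_stable s Us)).
have Un : \forall s \near t, U s by exact: open_nbhs_nbhs.
pose W := [set s | U s /\ I s = I t].
have Wn : nbhs t W.
  apply: filterS3 Un cardI (I_stable t Ut) => s Us cards sub; split=> //.
  by apply/esym/eqP; rewrite eqEcard sub cards leqnn.
exists (~: I t)%SET, (W°); split.
- exact: open_interior.
- by exists t; exact: Wn.
- by move=> s /interior_subset[].
move=> s /interior_subset[Us Is]; have [gs hs] := fK s Us.
split=> // i; rewrite inE -Is inE; last by rewrite negbK.
by move=> gi; apply/eqP; rewrite eq_le gs leNgt.
Qed.

End Cells.

Lemma open_cube_neq0 (R : realType) d : @open_cube R d !=set0.
Proof.
exists (const_mx (2^-1)) => i; rewrite mxE invr_gt0 ltr0n /=.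
by rewrite invf_lt1 ?ltr1n ?ltr0n.
Qed.

Theorem theorem3p3 (R : realType) (n m l : nat)
    (F : 'I_n -> mpolynomial R n)
    (g : 'I_m -> mpolynomial R n) (h : 'I_l -> mpolynomial R n)
    (g_convex : forall i, convex_poly (g i))
    (h_affine : forall j, affine_poly (h j))
    (K_nonempty : feasible_set g h !=set0)
    (K_ACQ : forall x, feasible_set g h x -> ACQ g h x)
    (r : {set 'I_m} -> nat)
    (rank_DPhi : forall (alpha : {set 'I_m}) (x : 'rV[R]_n)
       (lambda : 'rV[R]_#|alpha|), \rank (DPhi F g h x lambda) = r alpha)
    (dim_Sol : \bar int) (dim_K : {set 'I_m} -> \bar int)
    (dim_SolE : has_dim (Sol F (feasible_set g h)) dim_Sol)
    (dim_KE : forall alpha, has_dim (pseudo_face g h alpha) (dim_K alpha)) :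
  (dim_Sol <= \big[Order.max/-oo]_(alpha : {set 'I_m})
     Order.min (dim_K alpha)
       ((n + #|alpha| + l)%:Z - (r alpha)%:Z)%:E)%E.
Proof.
have [N [C [e [[SolE _ _ charts] ->]]]] := dim_SolE.
apply: bigmax_le => [|i _]; first exact: leNye.
have [f fchart] := charts i.
have fSol t : open_cube t -> Sol F (feasible_set g h) (f t).
  have [[fC _ _] _ _ _] := fchart.
  by move=> /fC Cft; rewrite SolE; exists i.
(* The subset alpha of the bound depends on the cell. *)
have [alpha [V [Vop V0 Vcube fV]]] := locally_in_pseudo_face
  (@open_cube_open R (e i)) (open_cube_neq0 R (e i))
  (chart_continuous fchart) (fun t tcube => (fSol t tcube).1).
apply: le_trans (le_bigmax _ _ alpha); rewrite le_min; apply/andP; split.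
  apply: chart_dim_le_cover fchart (dim_KE alpha) Vop V0 Vcube _.
  by move=> _ [t Vt <-]; exact: fV.
rewrite lee_fin lerBrDr -PoszD lez_nat.
apply: (Sol_dim_le_corank Vop V0 _ _ fV _ h_affine (@rank_DPhi alpha)).
- by move=> t /Vcube; exact: (chart_differentiable fchart).
- by move=> t /Vcube; exact: (chart_rank fchart).
- move=> t Vt; have solt := fSol t (Vcube t Vt).
  exact: KKT_span solt (fV t Vt) (K_ACQ _ solt.1).
Qed.
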